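(* Every random matching policy (including every priority policy and the class-uniform policy U) and the policy ''Match the Longest'' (ML) are sub-additive.
   Context: Let $G=(\mathcal V,\mathcal E)$ be a finite connected simple graph with $\mathcal V=\{1,\dots,|\mathcal V|\}$; $\mathcal E(v)$ is the set of neighbors of $v$. For a finite word $w\in\mathcal V^*$, $|w|$ is its length, $|w|_i$ the number of occurrences of letter $i$, $[w]=(|w|_i)_{i\in\mathcal V}$ its commutative image, $\emptyset$ the empty word. Let $\mathbb W=\{w\in\mathcal V^*:|w|_i|w|_j=0\text{ for all }(i,j)\in\mathcal E\}$ (queue details: classes of stored items in order of arrival) and $\mathbb X=\{[w]:w\in\mathbb W\}$ (class details). Let $\mathcal S=S_{\mathcal E(1)}\times\cdots\times S_{\mathcal E(|\mathcal V|)}$ (lists of preferences), where $S_A$ is the group of permutations of $A$; for $\sigma\in\mathcal S$, $\sigma(v)[i]$ is the image of $i\in\mathcal E(v)$ under $\sigma(v)$. A class-admissible matching policy $\phi$ is given by a probability distribution $\nu_\phi$ on $\mathcal S$ and a map $p_\phi$ such that $p_\phi(x,v,\sigma)\in\mathcal P(x,v):=\{j\in\mathcal E(v):x(j)>0\}$ whenever $\mathcal P(x,v)\ne\emptyset$. It acts on $\mathbb W$ by $w\odot_\phi(v,\sigma)=wv$ if $\mathcal P([w],v)=\emptyset$, and otherwise $w\odot_\phi(v,\sigma)$ is obtained from $w$ by deleting the first (oldest) occurrence of the letter $p_\phi([w],v,\sigma)$. Random policy: $\nu_\phi$ arbitrary and $p_\phi(x,v,\sigma)=\sigma(v)[k]$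 with $k=\min\{i\in\mathcal E(v):\sigma(v)[i]\in\mathcal P(x,v)\}$. Priority policy: random policy with $\nu_\phi=\delta_{\sigma^0}$ for a fixed $\sigma^0\in\mathcal S$. U: random policy with $\nu_\phi$ uniform on $\mathcal S$. ML: $\nu_\phi$ uniform on $\mathcal S$ and $p_\phi(x,v,\sigma)=\sigma(v)[k]$ with $k=\min\{i\in\mathcal E(v):\sigma(v)[i]\in\mathcal L(x,v)\}$, where $\mathcal L(x,v)=\{i\in\mathcal E(v):x(i)=\max_{j\in\mathcal E(v)}x(j)\}$. For $z=v_1\cdots v_n\in\mathcal V^*$ and $\varsigma=\sigma_1\cdots\sigma_n\in\mathcal S^*$, $W_\phi(z,\varsigma)\in\mathbb W$ is the queue detail obtained from $\emptyset$ by applying successively $\odot_\phi(v_1,\sigma_1),\dots,\odot_\phi(v_n,\sigma_n)$. $\phi$ is sub-additive if for all $z',z''\in\mathcal V^*$ and all $\varsigma',\varsigma''\in\mathcal S^*$ whose letters can be drawn by $\nu_\phi$ (i.e. have positive $\nu_\phi$-probability), with $|\varsigma'|=|z'|$ and $|\varsigma''|=|z''|$, one has $|W_\phi(z'z'',\varsigma'\varsigma'')|\le|W_\phi(z',\varsigma')|+|W_\phi(z'',\varsigma'')|$. *)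

(* Defs.v *)
From HB Require Import structures.
From mathcomp Require Import all_boot all_order all_fingroup all_algebra.
From mathcomp Require Import reals.

Set Implicit Arguments.
Unset Strict Implicit.
Unset Printing Implicit Defensive.

Import Order.TTheory GRing.Theory Num.Theory.

Local Open Scope ring_scope.

Record distr (R : realType) (T : finType) := Distr {
  pmf :> {ffun T -> R};
  pmf_ge0 : forall t, 0 <= pmf t;
  pmf_sum1 : \sum_t pmf t = 1
}.

Section Dirac.
Variables (R : realType) (T : finType) (t0 : T).

Definition dirac_pmf : {ffun T -> R} := [ffun t => (t == t0)%:R].

Lemma dirac_ge0 t : 0 <= dirac_pmf t.
Proof. by rewrite ffunE ler0n. Qed.

Lemma dirac_sum1 : \sum_t dirac_pmf t = 1.
Proof.
rewrite (bigD1 t0) //= ffunE eqxx big1 ?addr0 // => t /negPf t_neq.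
by rewrite ffunE t_neq.
Qed.

Definition dirac_distr : distr R T := Distr dirac_ge0 dirac_sum1.

End Dirac.

Section Uniform.
(* The witness [t0] only records that [T] is inhabited. *)
Variables (R : realType) (T : finType) (t0 : T).

Definition uniform_pmf : {ffun T -> R} := [ffun=> #|T|%:R^-1].

Lemma uniform_ge0 t : 0 <= uniform_pmf t.
Proof. by rewrite ffunE invr_ge0 ler0n. Qed.

Lemma uniform_sum1 : \sum_t uniform_pmf t = 1.
Proof.
under eq_bigr do rewrite ffunE.
rewrite sumr_const -[LHS]mulr_natr mulVf // pnatr_eq0 -lt0n.
by apply/card_gt0P; exists t0.
Qed.

Definition uniform_distr : distr R T := Distr uniform_ge0 uniform_sum1.

End Uniform.

Local Open Scope nat_scope.

(* A graph on the vertices {1, ..., n} is an edge relation on ['I_n], whose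
   order is that of the vertex labels. *)
Definition connected_simple_graph (n : nat) (e : rel 'I_n) : Prop :=
  [/\ 0 < n, symmetric e, irreflexive e & forall u v, connect e u v].

Section Model.
Variables (n : nat) (e : rel 'I_n).

Definition neighbors (v : 'I_n) : {set 'I_n} := [set j | e v j].

Definition is_queue (w : seq 'I_n) : bool :=
  [forall i, forall j, e i j ==> (count_mem i w * count_mem j w == 0)].

Definition comm_image (w : seq 'I_n) : {ffun 'I_n -> nat} :=
  [ffun i => count_mem i w].

Definition is_class_detail (x : {ffun 'I_n -> nat}) : Prop :=
  exists2 w, is_queue w & x = comm_image w.

Definition preferences :=
  {dffun forall v : 'I_n, {perm {j : 'I_n | j \in neighbors v}}}.

Definition id_preferences : preferences := [ffun v => 1%g].

Definition available (x : {ffun 'I_n -> nat}) (v : 'I_n) : {set 'I_n} :=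
  [set j in neighbors v | 0 < x j].

Definition longest (x : {ffun 'I_n -> nat}) (v : 'I_n) : {set 'I_n} :=
  [set i in neighbors v | x i == \max_(j in neighbors v) x j].

(* The vertex sigma(v)[k], where k is the least neighbor i of v such that
   sigma(v)[i] belongs to A; the value v is a dummy, used only when there is no
   such i. *)
Definition first_choice (A : {set 'I_n}) (v : 'I_n) (sigma : preferences) :
    'I_n :=
  let good (i : {j : 'I_n | j \in neighbors v}) := val (sigma v i) \in A in
  if [pick k | good k && [forall i, good i ==> (val k <= val i)]] is Some k
  then val (sigma v k) else v.

Lemma first_choice_mem (A : {set 'I_n}) v sigma :
  A \subset neighbors v -> A != set0 -> first_choice A v sigma \in A.
Proof.
move=> /subsetP sAN /set0Pn[a aA]; rewrite /first_choice.
case: pickP => [k /andP[] //|no_min].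
pose k0 : {j : 'I_n | j \in neighbors v} :=
  (sigma v)^-1%g (exist _ a (sAN a aA)).
have good_k0 : val (sigma v k0) \in A by rewrite permKV.
have := no_min [arg min_(k < k0 | val (sigma v k) \in A) val k].
case: arg_minnP => // k good_k k_min.
rewrite good_k /= => /negbT/negP; case.
by apply/forallP => i; apply/implyP; apply: k_min.
Qed.

Lemma available_sub x v : available x v \subset neighbors v.
Proof. by apply/subsetP => j; rewrite inE => /andP[]. Qed.

Lemma longest_sub x v : longest x v \subset neighbors v.
Proof. by apply/subsetP => j; rewrite inE => /andP[]. Qed.

Lemma longest_neq0 x v : available x v != set0 -> longest x v != set0.
Proof.
case/set0Pn => a; rewrite inE => /andP[aN _].
have [|i iN iE] := @eq_bigmax_cond _ (mem (neighbors v)) (fun j => x j).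
  by apply/card_gt0P; exists a.
by apply/set0Pn; exists i; rewrite inE iN /= iE.
Qed.

Lemma longest_available x v :
  available x v != set0 -> longest x v \subset available x v.
Proof.
case/set0Pn => a; rewrite inE => /andP[aN xa_gt0].
apply/subsetP => i; rewrite !inE => /andP[-> /eqP->] /=.
by apply: leq_trans xa_gt0 _; apply: leq_bigmax_cond.
Qed.

Section Policies.
Variable R : realType.

(* [choice] is total for convenience: only its values at class details [x] with
   [available x v != set0] matter. *)
Record policy := Policy {
  pref_distr : distr R preferences;
  choice : {ffun 'I_n -> nat} -> 'I_n -> preferences -> 'I_n;
  choice_available : forall x v sigma, is_class_detail x ->
    available x v != set0 -> choice x v sigma \in available x v
}.

(* Words list the stored items from oldest to newest; [rem] deletes the first
   occurrence. *)
Definition arrival (phi : policy) (w : seq 'I_n) (a : 'I_n * preferences) :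
    seq 'I_n :=
  if available (comm_image w) a.1 == set0 then rcons w a.1
  else rem (choice phi (comm_image w) a.1 a.2) w.

Definition queue_detail (phi : policy) (z : seq 'I_n) (s : seq preferences) :
    seq 'I_n :=
  foldl (arrival phi) [::] (zip z s).

Lemma arrival_is_queue (phi : policy) w a :
  symmetric e -> irreflexive e -> is_queue w -> is_queue (arrival phi w a).
Proof.
move=> e_sym e_irr /forallP w_queue; rewrite /arrival.
have qw i j : e i j -> count_mem i w * count_mem j w = 0.
  by move=> eij; have /forallP/(_ j)/implyP/(_ eij)/eqP := w_queue i.
case: ifP => [/eqP av0|_]; apply/forallP => i; apply/forallP => j;
    apply/implyP => eij.
  have av j' : e a.1 j' -> count_mem j' w = 0.
    move=> eaj; have := in_set0 j'; rewrite -av0 !inE eaj ffunE /=.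
    by move/negbT; rewrite -eqn0Ngt => /eqP.
  rewrite -cats1 !count_cat /= !addn0.
  case: (eqVneq a.1 i) => [ai|_]; case: (eqVneq a.1 j) => [aj|_] /=.
  - by rewrite -ai -aj e_irr in eij.
  - by rewrite (av j) ?addn0 ?muln0 // ai.
  - by rewrite (av i) ?addn0 // aj e_sym.
  - by rewrite !addn0 qw.
set b := choice _ _ _ _.
have sub c : count_mem c (rem b w) <= count_mem c w.
  exact/leq_count_subseq/rem_subseq.
by rewrite -leqn0 -(qw i j eij) leq_mul.
Qed.

Lemma queue_detail_is_queue (phi : policy) z s :
  symmetric e -> irreflexive e -> is_queue (queue_detail phi z s).
Proof.
move=> e_sym e_irr; rewrite /queue_detail.
have : is_queue [::] by apply/forallP => i; apply/forallP => j; apply/implyP.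
elim: (zip z s) [::] => //= a zs IH w w_queue.
exact/IH/arrival_is_queue.
Qed.

Definition sub_additive (phi : policy) : Prop :=
  forall (z' z'' : seq 'I_n) (s' s'' : seq preferences),
    {in s', forall sigma, (0 < pref_distr phi sigma)%R} ->
    {in s'', forall sigma, (0 < pref_distr phi sigma)%R} ->
    size s' = size z' -> size s'' = size z'' ->
    size (queue_detail phi (z' ++ z'') (s' ++ s''))
      <= size (queue_detail phi z' s') + size (queue_detail phi z'' s'').

Definition random_choice (x : {ffun 'I_n -> nat}) (v : 'I_n) :=
  first_choice (available x v) v.

Lemma random_choice_available x v sigma : is_class_detail x ->
  available x v != set0 -> random_choice x v sigma \in available x v.
Proof. by move=> _; apply/first_choice_mem/available_sub. Qed.

Definition random_policy (nu : distr R preferences) : policy :=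
  Policy nu random_choice_available.

Definition priority_policy (sigma0 : preferences) : policy :=
  random_policy (dirac_distr R sigma0).

Definition uniform_policy : policy :=
  random_policy (uniform_distr R id_preferences).

Definition longest_choice (x : {ffun 'I_n -> nat}) (v : 'I_n) :=
  first_choice (longest x v) v.

Lemma longest_choice_available x v sigma : is_class_detail x ->
  available x v != set0 -> longest_choice x v sigma \in available x v.
Proof.
move=> _ av; apply: (subsetP (longest_available av)).
exact: first_choice_mem (longest_sub x v) (longest_neq0 av).
Qed.

Definition match_the_longest : policy :=
  Policy (uniform_distr R id_preferences) longest_choice_available.

End Policies.
End Model.

Arguments priority_policy {n e} R sigma0.

(* Main.v *)
Require Import Defs.
From HB Require Import structures.
From mathcomp Require Import all_boot all_order all_fingroup all_algebra.
From mathcomp Require Import reals.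
From mathcomp Require Import zify.

(** Measure the gap between two queue details by the l1 distance of their
    commutative images. If an arrival never increases this distance, feeding
    [z''] to a queue started at [W(z')] and to an empty queue keeps the two
    results within [|W(z')|] of each other, and since the length is the distance
    to the empty word, sub-additivity follows ([non_expansive_sub_additive]).

    An arrival changes one coordinate by one in each queue. If the changes are
    not the same, it suffices that one of them brings the queues closer, which
    pays for the other ([sum_leq_transfer]). This is automatic when only one of
    the queues is served, since the class that it loses is absent from the other
    queue. When both lose an item, of distinct classes [i] and [j], it suffices that the first queue had strictly more items of class [i]
    than the second, or the second strictly more of class [j] than the first.
    This is the property [contrasting] of the choice rule
    ([contrasting_non_expansive]).

    Both rules pick the preferred element of a candidate set. Such picks from
    two sets can differ only if one of them lies outside the other set
    ([first_choice_agree]). When the candidates are the available classes, the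
    missing class is absent from one queue and present in the other. When they
    are the longest classes, the failure of both strict inequalities forces the
    two queues to have equally many items of [i] and of [j], so that both classes
    are longest in both queues, and the picks agree after all. *)

Set Implicit Arguments.
Unset Strict Implicit.
Unset Printing Implicit Defensive.

(** One unit gained at [b] is offset by one unit lost at [a]. Keeping the terms [i == a] and [i == b] on opposite
    sides avoids subtraction and makes [a = b] unexceptional. *)
Lemma sum_leq_transfer (T : finType) (d d' : T -> nat) (a b : T) :
  (forall i, d' i + (i == a) <= d i + (i == b)) ->
  \sum_i d' i <= \sum_i d i.
Proof.
move=> le_d; have sum1 c : \sum_(i : T) (i == c : nat) = 1.
  by rewrite (bigD1 c) //= eqxx big1 ?addn0 // => i /negPf ->.
rewrite -(leq_add2r 1) -{1}(sum1 a) -(sum1 b) -!big_split.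
exact: leq_sum.
Qed.

Section SubAdditivity.
Variables (n : nat) (e : rel 'I_n).

Definition class_dist (w u : seq 'I_n) : nat :=
  \sum_i ((count_mem i w - count_mem i u) + (count_mem i u - count_mem i w)).

Lemma size_sum_count (w : seq 'I_n) : size w = \sum_i count_mem i w.
Proof.
elim: w => [|a w IH] /=; first by rewrite big1.
rewrite big_split /= -IH (bigD1 a) //= eqxx big1 // => i.
by rewrite eq_sym => /negPf ->.
Qed.

Lemma class_distC w u : class_dist w u = class_dist u w.
Proof. by apply: eq_bigr => i _; rewrite addnC. Qed.

Lemma class_dist_nil w : class_dist w [::] = size w.
Proof.
by rewrite size_sum_count; apply: eq_bigr => i _; rewrite subn0 sub0n addn0.
Qed.

Lemma size_leq_class_dist w u : size w <= class_dist w u + size u.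
Proof.
rewrite !size_sum_count -big_split /=; apply: leq_sum => i _; lia.
Qed.

(** The class [j] is absent from [u], so losing it brings [w] closer to [u];
    this offsets the new item of class [v] in [u]. *)
Lemma class_dist_rem_rcons (w u : seq 'I_n) (j v : 'I_n) :
  0 < count_mem j w -> count_mem j u = 0 ->
  class_dist (rem j w) (rcons u v) <= class_dist w u.
Proof.
move=> jw ju; apply: (@sum_leq_transfer _ _ _ j v) => i.
rewrite count_mem_rem -cats1 count_cat /= addn0 !(eq_sym _ i).
case: (eqVneq i j) => [->|_].
  by rewrite ju; move: (count_mem j w) jw => c; case: eqP => _ /=; lia.
by move: (count_mem i w) (count_mem i u) => c d; case: eqP => _ /=; lia.
Qed.

(** The gain at [i] offsets whatever the removal of [j] from [u] may cost. *)
Lemma class_dist_rem_rem (w u : seq 'I_n) (i j : 'I_n) :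
  i != j -> count_mem i u < count_mem i w ->
  class_dist (rem i w) (rem j u) <= class_dist w u.
Proof.
move=> neq_ij lt_i; apply: (@sum_leq_transfer _ _ _ i j) => k.
rewrite !count_mem_rem !(eq_sym _ k).
case: (eqVneq k i) => [->|_]; last first.
  by move: (count_mem k w) (count_mem k u) => c d; case: eqP => _ /=; lia.
rewrite (negPf neq_ij) /=.
by move: (count_mem i w) (count_mem i u) lt_i => c d; lia.
Qed.

Section FirstChoice.
Implicit Types (A B : {set 'I_n}) (v : 'I_n) (sigma : preferences e).

(** The default value in [first_choice] is never used when [A] is non-empty:
    otherwise [v] itself would be a candidate, hence a minimal one would exist. *)
Lemma first_choiceP A v sigma : A \subset neighbors e v -> A != set0 ->
  exists2 k, first_choice A v sigma = val (sigma v k) &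
    val (sigma v k) \in A /\
    forall i, val (sigma v i) \in A -> val k <= val i.
Proof.
move=> /[dup] /subsetP sAN sA A_neq0.
have := first_choice_mem sigma sA A_neq0; rewrite /first_choice.
case: pickP => [k /andP[good_k /forallP k_min] _|no_min vA].
  by exists k => //; split => // i; move/implyP: (k_min i).
pose k0 : {j : 'I_n | j \in neighbors e v} :=
  ((sigma v)^-1)%g (exist _ v (sAN v vA)).
have good_k0 : val (sigma v k0) \in A by rewrite permKV.
have := no_min [arg min_(k < k0 | val (sigma v k) \in A) val k].
case: arg_minnP => // k -> k_min /negbT/negP; case.
by apply/forallP => i; apply/implyP; apply: k_min.
Qed.

(** Each pick is a candidate for the other set, so neither can be preferred to
    the other. *)
Lemma first_choice_agree A B v sigma :
  A \subset neighbors e v -> B \subset neighbors e v ->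
  first_choice A v sigma \in B -> first_choice B v sigma \in A ->
  A != set0 -> B != set0 ->
  first_choice A v sigma = first_choice B v sigma.
Proof.
move=> sA sB + + A_neq0 B_neq0.
have [k -> [_ k_min]] := first_choiceP sigma sA A_neq0.
have [l -> [_ l_min]] := first_choiceP sigma sB B_neq0.
move=> /l_min le_lk /k_min le_kl; congr (val (sigma v _)).
by apply/val_inj/val_inj/eqP; rewrite eqn_leq le_kl.
Qed.

End FirstChoice.

Section Policies.
Variable R : realType.

Definition non_expansive (phi : policy e R) : Prop :=
  forall w u a, is_queue e w -> is_queue e u ->
    class_dist (arrival phi w a) (arrival phi u a) <= class_dist w u.

(** When two queues lose different classes, some lost class was in strict excess
    in the queue that loses it, so its loss brings the two queues closer. *)
Definition contrasting (phi : policy e R) : Prop :=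
  forall x y v sigma, available e x v != set0 -> available e y v != set0 ->
    let i := choice phi x v sigma in let j := choice phi y v sigma in
    i != j -> y i < x i \/ x j < y j.

Lemma class_detail_comm_image w : is_queue e w ->
  is_class_detail e (comm_image w).
Proof. by exists w. Qed.

(** If exactly one queue can serve the arrival, [class_dist_rem_rcons] applies;
    if both can, the contrast selects the queue in which [class_dist_rem_rem]
    finds a coordinate that gets closer. *)
Lemma contrasting_non_expansive phi : contrasting phi -> non_expansive phi.
Proof.
move=> phi_contr w u [v sigma] qw qu; rewrite /arrival /=.
have choice_count t : is_queue e t ->
    available e (comm_image t) v != set0 ->
    choice phi (comm_image t) v sigma \in neighbors e v /\
    0 < count_mem (choice phi (comm_image t) v sigma) t.
  move=> qt av_t.
  have := choice_available phi sigma (class_detail_comm_image qt) av_t.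
  by rewrite inE ffunE => /andP[].
have absent t j : available e (comm_image t) v = set0 ->
    j \in neighbors e v -> count_mem j t = 0.
  move=> av0 jN; have := in_set0 j; rewrite -av0 inE jN ffunE /=.
  by move/negbT; rewrite -eqn0Ngt => /eqP.
case: eqVneq => [w0|w_av]; case: eqVneq => [u0|u_av].
- by apply: leq_sum => i _; rewrite -!cats1 !count_cat; lia.
- have [jN ju] := choice_count u qu u_av.
  by rewrite class_distC (class_distC w); apply: class_dist_rem_rcons => //;
     apply: absent jN.
- have [jN jw] := choice_count w qw w_av.
  by apply: class_dist_rem_rcons => //; apply: absent jN.
have := phi_contr _ _ v sigma w_av u_av => /=.
case: eqVneq => [-> _|neq_ij].
  by apply: leq_sum => i _; rewrite !count_mem_rem; lia.
rewrite !ffunE => /(_ isT) [lt_i|lt_j]; first exact: class_dist_rem_rem.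
rewrite class_distC (class_distC w).
by apply: class_dist_rem_rem => //; rewrite eq_sym.
Qed.

(** After [z'], the system and a fresh copy started empty receive the same
    arrivals [z'']; their initial distance is [|W(z')|]. *)
Lemma non_expansive_sub_additive phi : symmetric e -> irreflexive e ->
  non_expansive phi -> sub_additive phi.
Proof.
move=> e_sym e_irr phi_ne z' z'' s' s'' _ _ sz' _.
have foldl_ne zs w u : is_queue e w -> is_queue e u ->
    class_dist (foldl (arrival phi) w zs) (foldl (arrival phi) u zs)
      <= class_dist w u.
  elim: zs w u => //= a zs IH w u qw qu.
  by apply: leq_trans (IH _ _ _ _) (phi_ne w u a qw qu);
     apply: arrival_is_queue.
have queue_nil : is_queue e [::].
  by apply/forallP => i; apply/forallP => j; apply/implyP.
have qW := queue_detail_is_queue phi z' s' e_sym e_irr.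
rewrite {1}/queue_detail zip_cat // foldl_cat.
apply: leq_trans (size_leq_class_dist _ (queue_detail phi z'' s'')) _.
by rewrite leq_add2r -class_dist_nil; apply: foldl_ne.
Qed.

(** A class that is not a candidate in one of the queues is absent from it, but
    present in the queue that loses it. *)
Lemma random_contrasting (nu : distr R (preferences e)) :
  contrasting (random_policy nu).
Proof.
move=> x y v sigma x_av y_av /=; rewrite /random_choice.
set i := first_choice (available e x v) v sigma.
set j := first_choice (available e y v) v sigma => neq_ij.
have sub t := available_sub e t v.
have := first_choice_mem sigma (sub x) x_av.
have := first_choice_mem sigma (sub y) y_av.
rewrite -/i -/j !inE => /andP[jN yj] /andP[iN xi].
have [yi|yi] := leqP (y i) 0; first by left; lia.
have [xj|xj] := leqP (x j) 0; first by right; lia.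
case/eqP: neq_ij; apply: first_choice_agree => //.
  by rewrite !inE iN.
by rewrite !inE jN.
Qed.

(** Without a strict excess, both queues have equally long classes [i] and [j],
    and the common preference list breaks the tie in the same way. *)
Lemma longest_contrasting : contrasting (match_the_longest e R).
Proof.
move=> x y v sigma x_av y_av /=; rewrite /longest_choice.
set i := first_choice (longest e x v) v sigma.
set j := first_choice (longest e y v) v sigma => neq_ij.
have x_lg := longest_neq0 x_av; have y_lg := longest_neq0 y_av.
have sub t := longest_sub e t v.
have := first_choice_mem sigma (sub x) x_lg.
have := first_choice_mem sigma (sub y) y_lg.
rewrite -/i -/j !inE => /andP[jN /eqP yj] /andP[iN /eqP xi].
have le_x : x j <= x i by rewrite xi; apply: leq_bigmax_cond; rewrite inE.
have le_y : y i <= y j by rewrite yj; apply: leq_bigmax_cond; rewrite inE.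
have [yi|] := ltnP (y i) (x i); first by left.
have [xj|] := ltnP (x j) (y j); first by right.
(* Here [x i <= y i <= y j <= x j <= x i], so all four are equal. *)
move=> le_j le_i; case/eqP: neq_ij; apply: first_choice_agree => //.
  by rewrite !inE iN -yj eqn_leq le_y (leq_trans le_j (leq_trans le_x le_i)).
by rewrite !inE jN -xi eqn_leq le_x (leq_trans le_i (leq_trans le_y le_j)).
Qed.

End Policies.
End SubAdditivity.

Theorem corollary1 (R : realType) (n : nat) (e : rel 'I_n)
    (e_graph : connected_simple_graph e) :
  [/\ forall nu : distr R (preferences e), sub_additive (random_policy nu),
      forall sigma0 : preferences e, sub_additive (priority_policy R sigma0),
      sub_additive (uniform_policy e R)
    & sub_additive (match_the_longest e R)].
Proof.
case: e_graph => _ e_sym e_irr _.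
have sub_add (phi : policy e R) : contrasting phi -> sub_additive phi.
  by move/contrasting_non_expansive/(non_expansive_sub_additive e_sym e_irr).
split=> [nu|sigma0||]; apply: sub_add; try exact: random_contrasting.
exact: longest_contrasting.
Qed.
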